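(* Let $(\mathcal G,\lambda)$ be a locally compact semigroupoid with quasi-Haar system $\lambda$. If $(\mathcal G,\lambda)$ is uniform and tight Reiter, then it is Liouville.
   Context: A semigroupoid is a small category: a set $\mathcal G$ of morphisms, a set $\mathcal G^{(0)}$ of objects (units), surjective source and target maps $\mathbf s,\mathbf t:\mathcal G\to\mathcal G^{(0)}$, and a composition $(\zeta,\eta)\mapsto\zeta\eta$ on $\mathcal G^{(2)}=\{(\zeta,\eta)\in\mathcal G^2:\mathbf s(\zeta)=\mathbf t(\eta)\}$. Units are identified with identity morphisms, so $\mathcal G^{(0)}\subseteq\mathcal G$. For $x\in\mathcal G^{(0)}$ put $\mathcal G^x=\mathbf t^{-1}(x)$. A topological semigroupoid is a semigroupoid with a topology on $\mathcal G$ such that the composition, $\mathbf s$ and $\mathbf t$ are continuous. A locally compact semigroupoid is a topological semigroupoid which is locally compact, Hausdorff and second countable. A continuous system of measures on $\mathcal G$ is a family $\lambda=(\lambda^x)_{x\in\mathcal G^{(0)}}$ of nonzero $\sigma$-finite positive Radon measures $\lambda^x$ on $\mathcal G^x$ (regarded also as measures on $\mathcal G$ vanishing outside $\mathcal G^x$) such that $x\mapsto\int f\,d\lambda^x$ is continuous for every $f\in C_c(\mathcal G)$. For $\gamma\in\mathcal G$ and a measure $\rho$ on $\mathcal G^{\mathbf s(\gamma)}$, $\gamma\rho$ is the pushforward of $\rho$ under $\mathcal G^{\mathbf s(\gamma)}\to\mathcal G^{\mathbf t(\gamma)}$, $\eta\mapsto\gamma\eta$; $\prec$ denotes absolute continuity.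 A quasi-Haar system is a continuous system of measures $\lambda$ such that $\gamma\lambda^{\mathbf s(\gamma)}\prec\lambda^{\mathbf t(\gamma)}$ for all $\gamma$ and $(\gamma,\eta)\in\mathcal G^2\mapsto\frac{d(\gamma\lambda^{\mathbf s(\gamma)})}{d\lambda^{\mathbf t(\gamma)}}(\eta)\in[0,\infty]$ is Borel. A continuous system $\theta=(\theta^x)_x$ of probability measures $\theta^x$ on $\mathcal G^x$ is $\lambda$-adapted if $\theta^x\prec\lambda^x$ for every $x$ and $(\gamma,\eta)\in\mathcal G^2\mapsto\frac{d(\gamma\theta^{\mathbf s(\gamma)})}{d\lambda^{\mathbf t(\gamma)}}(\eta)\in[0,\infty]$ is Borel. For $K\subseteq\mathcal G^{(0)}$ compact, $\mathrm{supp}_K(\theta)=\overline{\bigcup_{x\in K}\mathrm{supp}\,\theta^x}$. $\|\cdot\|$ is the total variation norm. $(\mathcal G,\lambda)$ is uniform and tight Reiter if there is a sequence $(\theta_n)_n$ of $\lambda$-adapted continuous systems of probability measures such that $\lim_{n\to\infty}\|\theta_n^{\mathbf t(\gamma)}-\gamma\theta_n^{\mathbf s(\gamma)}\|=0$ uniformly for $\gamma$ in compact subsets of $\mathcal G$, and $\mathrm{supp}_K(\theta_n)$ is compact for every $n$ and every compact $K\subseteq\mathcal G^{(0)}$. For a $\lambda$-adapted continuous system of probability measures $\pi=(\pi_x)_x$, define $P_x$ on $L^\infty(\mathcal G^x,\lambda^x)$ by $P_x(f)(\zeta)=\int_{\mathcal G^{\mathbf s(\zeta)}}f(\zeta\eta)\,d\pi_{\mathbf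 s(\zeta)}(\eta)$, and $H_{\pi,x}(\mathcal G)=\{f\in L^\infty(\mathcal G^x,\lambda^x):P_x(f)=f\}$. $(\mathcal G,\lambda)$ is Liouville if there is a $\lambda$-adapted continuous system of probability measures $\pi$ with $H_{\pi,x}(\mathcal G)=\mathbb C\mathbf 1$ (the constants) for all $x\in\mathcal G^{(0)}$. *)

(* Defs.v *)
From HB Require Import structures.
From mathcomp Require Import all_boot all_order all_algebra.
From mathcomp Require Import all_classical all_reals all_analysis.
From mathcomp Require Import measurable_realfun.
From mathcomp Require Export complex.

Set Implicit Arguments.
Unset Strict Implicit.
Unset Printing Implicit Defensive.

Import Order.TTheory GRing.Theory Num.Theory.
Import numFieldNormedType.Exports.

Local Open Scope classical_set_scope.
Local Open Scope ring_scope.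

(* Objects are identified with their identity morphisms, so [src] and [tgt] are
   endomaps of the set [G] of morphisms.  The composition [sg_mul g h] is total;
   its value is meaningless unless [src g = tgt h]. *)
Record semigroupoid (G : Type) := Semigroupoid {
  src : G -> G;
  tgt : G -> G;
  sg_mul : G -> G -> G;
  src_src : forall g, src (src g) = src g;
  tgt_src : forall g, tgt (src g) = src g;
  src_tgt : forall g, src (tgt g) = tgt g;
  tgt_tgt : forall g, tgt (tgt g) = tgt g;
  src_mul : forall g h, src g = tgt h -> src (sg_mul g h) = src h;
  tgt_mul : forall g h, src g = tgt h -> tgt (sg_mul g h) = tgt g;
  mul_tgt : forall g, sg_mul (tgt g) g = g;
  mul_src : forall g, sg_mul g (src g) = g;
  sg_mulA : forall g h k, src g = tgt h -> src h = tgt k ->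
    sg_mul g (sg_mul h k) = sg_mul (sg_mul g h) k }.

Definition sg_units (G : Type) (C : semigroupoid G) : set G :=
  [set x | src C x = x].

Definition composable (G : Type) (C : semigroupoid G) : set (G * G) :=
  [set p | src C p.1 = tgt C p.2].

Definition fiber (G : Type) (C : semigroupoid G) (x : G) : set G :=
  tgt C @^-1` [set x].

Record topological_semigroupoid (G : topologicalType) (C : semigroupoid G)
    : Prop := {
  src_continuous : continuous (src C);
  tgt_continuous : continuous (tgt C);
  sg_mul_continuous :
    {within composable C, continuous (fun p : G * G => sg_mul C p.1 p.2)} }.

Record locally_compact_semigroupoid (G : topologicalType) (C : semigroupoid G)
    : Prop := {
  lc_topological : topological_semigroupoid C;
  lc_locally_compact : locally_compact [set: G];
  lc_hausdorff : hausdorff_space G;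
  lc_second_countable : @second_countable G }.

(* [T] with its Borel sigma-algebra; measurable types of the library are
   pointed, hence so is [T]. *)
Notation borel T := (@g_sigma_algebraType T%type open).

Section measures.
Context {R : realType} {G : ptopologicalType}.
Implicit Types (mu : {measure set (borel G) -> \bar R}) (f : G -> R[i]).

Record radon_measure mu : Prop := {
  radon_fin : forall K : set G, compact K -> (mu K < +oo)%E;
  radon_outer : forall A : set (borel G), measurable A ->
    mu A = ereal_inf [set mu U | U in [set U : set G | open U /\ A `<=` U]];
  radon_inner : forall U : set G, open U ->
    mu U = ereal_sup [set mu K | K in [set K : set G | compact K /\ K `<=` U]] }.

Definition measure_support mu : set G :=
  [set y | forall U : set G, open_nbhs y U -> (0 < mu U)%E].

Definition total_variation_norm (nu : set (borel G) -> \bar R) : \bar R :=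
  ereal_sup [set v | exists (n : nat) (F : (set (borel G))^nat),
    [/\ forall i, measurable (F i),
        trivIset `I_n F,
        \bigcup_(i in `I_n) F i = [set: G] &
        v = (\sum_(i < n) `|nu (F i)|)%E]].

Definition cintegral mu (D : set (borel G)) f : R[i] :=
  Complex (\int[mu]_(y in D) complex.Re (f y))
          (\int[mu]_(y in D) complex.Im (f y)).

(* Representatives of the elements of the complex space L^oo(mu). *)
Definition Linfty mu : set (G -> R[i]) :=
  [set f | ((fun y => complex.Re (f y)) : borel G -> R) \in Lfun mu +oo%E /\
           ((fun y => complex.Im (f y)) : borel G -> R) \in Lfun mu +oo%E].

(* [R[i]^o] is R[i] with the topology of the modulus. *)
Definition Cc : set (G -> R[i]) :=
  [set f | continuous (f : G -> R[i]^o) /\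
           compact (closure [set y | f y != 0])].

End measures.

Section systems.
Context {R : realType} {G : ptopologicalType} (C : semigroupoid G).

(* A family (rho^x) indexed by the units x of [G]; the values of the family at
   non-units are irrelevant. *)
Definition measure_family := G -> {measure set (borel G) -> \bar R}.

Implicit Types (lambda theta pi rho : measure_family).

Record continuous_system lambda : Prop := {
  cs_fiber : forall x, sg_units C x -> lambda x (~` fiber C x) = 0%E;
  cs_nonzero : forall x, sg_units C x -> lambda x [set: G] <> 0%E;
  cs_sigma_finite : forall x, sg_units C x ->
    sigma_finite [set: borel G] (lambda x);
  cs_radon : forall x, sg_units C x -> radon_measure (lambda x);
  cs_continuous : forall f : G -> R[i], Cc f ->
    {within sg_units C, continuous
      (fun x => cintegral (lambda x) [set: G] f : R[i]^o)} }.

(* Pushforward of [rho] under [sg_mul C g : fiber C (src C g) -> fiber C (tgt C g)];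
   the intersection discards the meaningless values of [sg_mul]. *)
Definition translate (g : G) (rho : {measure set (borel G) -> \bar R})
    : set (borel G) -> \bar R :=
  fun A => rho (fiber C (src C g) `&` sg_mul C g @^-1` A).

(* The Radon-Nikodym derivatives are only defined almost everywhere, so that
   "(g, h) |-> d(g rho^{s(g)})/d lambda^{t(g)} (h) is Borel" asserts that they
   admit a jointly Borel version.  This version is sought on the whole of
   G x G: its values where tgt h <> tgt g play no role, since lambda^{t(g)}
   vanishes there. *)
Definition borel_derivative rho lambda : Prop :=
  exists D : borel (G * G) -> \bar R,
    [/\ measurable_fun [set: borel (G * G)] D,
        forall p, (0 <= D p)%E &
        forall (g : G) (A : set (borel G)), measurable A ->
          translate g (rho (src C g)) A =
            (\int[lambda (tgt C g)]_(h in A) D (g, h))%E].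

Record quasi_Haar lambda : Prop := {
  qH_system : continuous_system lambda;
  qH_dominated : forall g,
    translate g (lambda (src C g)) `<< lambda (tgt C g);
  qH_borel : borel_derivative lambda lambda }.

Record adapted lambda theta : Prop := {
  ad_system : continuous_system theta;
  ad_probability : forall x, sg_units C x -> theta x [set: G] = 1%E;
  ad_dominated : forall x, sg_units C x -> theta x `<< lambda x;
  ad_borel : borel_derivative theta lambda }.

Definition supp_on (K : set G) theta : set G :=
  closure (\bigcup_(x in K) measure_support (theta x)).

Definition uniform_tight_Reiter lambda : Prop :=
  exists theta : nat -> measure_family,
    [/\ forall n, adapted lambda (theta n),
        forall K : set G, compact K -> forall e : R, 0 < e ->
          \forall n \near \oo, forall g, K g ->
            (total_variation_norm (fun A =>
               theta n (tgt C g) A - translate g (theta n (src C g)) A) <= e%:E)%E &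
        forall (n : nat) (K : set G), K `<=` sg_units C -> compact K ->
          compact (supp_on K (theta n))].

Definition markov_operator pi (f : G -> R[i]) : G -> R[i] :=
  fun z => cintegral (pi (src C z)) (fiber C (src C z)) (fun h => f (sg_mul C z h)).

(* Both sets below consist of representatives: functions on [G], considered up
   to lambda^x-negligible sets (in particular up to their values off the fiber
   of x). *)
Definition harmonic_functions lambda pi (x : G) : set (G -> R[i]) :=
  [set f | Linfty (lambda x) f /\
           \forall z \ae lambda x, markov_operator pi f z = f z].

Definition constant_functions lambda (x : G) : set (G -> R[i]) :=
  [set f | Linfty (lambda x) f /\
           exists c : R[i], \forall z \ae lambda x, f z = c].

Definition Liouville lambda : Prop :=
  exists2 pi : measure_family, adapted lambda pi &
    forall x, sg_units C x ->
      harmonic_functions lambda pi x = constant_functions lambda x.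

End systems.

Arguments measure_family : clear implicits.

(* Main.v *)
Require Import Defs.
From mathcomp Require Import all_boot all_order all_algebra.
From mathcomp Require Import all_classical all_reals all_analysis.
From mathcomp Require Import measurable_realfun ess_sup_inf ring lra.

(** The measure making the semigroupoid Liouville is a mixture
    [pi = sum_l 2^-(l+1) theta_(u l)] of the given almost invariant systems, in
    the manner of Kaimanovich and Vershik.  The indices [u l] are chosen one
    after the other: exhaust [G] by compact sets [E i]; once [u l] is known for
    [l < i], let [K i] be the set reached from [E i] in at most [depth i] steps
    by the random walk whose increments are distributed according to these
    components, where [(1 - 2^-i)^(depth i) <= 2^-i].  Tightness makes [K i]
    compact, hence all later components can be taken almost invariant under
    [K i] ([select_components]).

    Let [f] be a bounded harmonic function on the fiber of [x].  Split [pi] into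
    its first [i] components, of total mass [1 - 2^-i], and its tail, of mass
    [2^-i].  The contribution of the tail to [f z] varies little for [z] in
    [K i], because it only involves the later components
    ([tail_average_dist]); it is therefore close to [2^-i a] for a constant [a].
    Thus [f z - a] is, up to a small error, [1 - 2^-i] times an average of
    [f - a] over points reached from [z] in one step.  Iterating this [depth i]
    times shows that [f] is within [O(2^-i)] of [a] on [E i]
    ([harmonic_contraction]), and [i] tends to infinity
    ([bounded_harmonic_constant]).  No convolution power of [pi] is formed, so
    harmonicity almost everywhere suffices: the increments avoid the exceptional
    set because translates of the components are absolutely continuous with
    respect to [lambda].

    The other ingredients are that [pi] is again an adapted continuous system
    ([mixture_system_adapted]), since truncating the series costs at most
    [2^-n] in total mass uniformly in the unit, and that a bound on the total
    variation controls integrals of bounded functions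
    ([le_Rintegral_distribution]). *)

Set Implicit Arguments.
Unset Strict Implicit.
Unset Printing Implicit Defensive.
Import Order.TTheory GRing.Theory Num.Theory.
Import numFieldNormedType.Exports.
Local Open Scope classical_set_scope.
Local Open Scope ring_scope.

(** * Integrals of bounded functions *)

Section bounded_integrals.
Context d (T : measurableType d) (R : realType).
Implicit Types (mu : {measure set T -> \bar R}) (D : set T) (f : T -> R).

Lemma integrable_bounded mu D f M : measurable D -> (mu D < +oo)%E ->
  measurable_fun D f -> (forall x, D x -> `|f x| <= M) ->
  mu.-integrable D (EFin \o f).
Proof.
move=> mD fD mf fM; apply: measurable_bounded_integrable => //.
exists M; split; first exact: num_real.
by move=> N MN x Dx; apply: le_trans (fM x Dx) (ltW MN).
Qed.

Lemma Rintegral_affine mu D f M r s : measurable D -> mu D = 1%E ->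
  measurable_fun D f -> (forall x, D x -> `|f x| <= M) ->
  \int[mu]_(x in D) (r * f x + s) = r * (\int[mu]_(x in D) f x) + s.
Proof.
move=> mD D1 mf fM.
have Doo : (mu D < +oo)%E by rewrite D1 ltry.
have If := integrable_bounded mD Doo mf fM.
rewrite RintegralD//.
- by rewrite RintegralZl// Rintegral_cst// D1 mulr1.
- apply: (@integrable_bounded _ _ _ (`|r| * M)) => //.
    by apply: measurable_funM.
  by move=> x Dx; rewrite normrM ler_wpM2l// fM.
- by apply: (@integrable_bounded _ _ (fun=> s) `|s|).
Qed.

Lemma Rintegral_dist mu D f a B : measurable D -> mu D = 1%E ->
  measurable_fun D f -> (forall x, D x -> `|f x - a| <= B) ->
  `|\int[mu]_(x in D) f x - a| <= B.
Proof.
move=> mD D1 mf fB.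
have fM x : D x -> `|f x| <= `|a| + B.
  by move=> Dx; rewrite -[f x](subrKC a) (le_trans (ler_normD _ _))// lerD2l fB.
have := Rintegral_affine 1 (- a) mD D1 mf fM; rewrite mul1r => <-.
under eq_Rintegral do rewrite mul1r.
have Doo : (mu D < +oo)%E by rewrite D1 ltry.
have mfa : measurable_fun D (fun x => f x - a) by apply: measurable_funB.
have If := integrable_bounded mD Doo mfa fB.
apply: (le_trans (le_normr_Rintegral _ _)) => //.
have -> : B = \int[mu]_(x in D) B by rewrite Rintegral_cst// D1 mulr1.
apply: le_Rintegral => //; last exact: (@integrable_bounded _ _ (fun=> B) `|B|).
apply: (@integrable_bounded _ _ (fun x => `|f x - a|) B) => //.
  exact: measurableT_comp.
by move=> x Dx; rewrite normr_id fB.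
Qed.

End bounded_integrals.

(** * Dyadic mixtures of probability measures *)

Section mixture.
Context d (T : measurableType d) (R : realType).
Variable m : nat -> {measure set T -> \bar R}.
Implicit Types (D : set T) (f : T -> R).

Definition dyadic (l : nat) : R := (2^-1) ^+ l.+1.

Lemma dyadic_ge0 l : 0 <= dyadic l.
Proof. by rewrite exprn_ge0. Qed.

Lemma sum_dyadic n : \sum_(l < n) dyadic l = 1 - (2^-1) ^+ n.
Proof.
elim: n => [|n ih]; first by rewrite big_ord0 expr0 subrr.
rewrite big_ord_recr/= ih /dyadic exprS; lra.
Qed.

Definition mixture : {measure set T -> \bar R} :=
  mseries (fun l => mscale (NngNum (dyadic_ge0 l)) (m l)) 0.

Lemma mixtureE A : mixture A = (\sum_(l <oo) (dyadic l)%:E * m l A)%E.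
Proof. by []. Qed.

Lemma ge0_integral_mixture D (f : T -> \bar R) : measurable D ->
  (forall x, D x -> (0 <= f x)%E) -> measurable_fun D f ->
  (\int[mixture]_(x in D) f x =
   \sum_(l <oo) (dyadic l)%:E * \int[m l]_(x in D) f x)%E.
Proof.
move=> mD f0 mf; rewrite ge0_integral_measure_series//.
by apply: eq_eseriesr => l _; rewrite ge0_integral_mscale.
Qed.

Lemma mixture_null A : (forall l, m l A = 0%E) -> mixture A = 0%E.
Proof. by move=> A0; rewrite mixtureE eseries0// => l _ _; rewrite A0 mule0. Qed.

Lemma mixture_prob D : (forall l, m l D = 1%E) -> mixture D = 1%E.
Proof.
move=> D1; rewrite mixtureE.
under eq_eseriesr do rewrite D1 mule1.
apply/cvg_lim => //.
rewrite (_ : (fun n => _) = EFin \o (fun n => 1 - (2^-1) ^+ n)); last first.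
  by apply/funext => n /=; rewrite sumEFin big_mkord sum_dyadic.
apply: cvg_EFin; first exact: nearW.
rewrite -[X in _ --> X]subr0; apply: cvgB; first exact: cvg_cst.
by apply: cvg_expr; rewrite ger0_norm// invf_lt1// ltr1n.
Qed.

(** The tail of the mixture has mass [2^-n], so that truncating the series
    changes the integral of a function bounded by [M] by at most [M * 2^-n].
    Only the lower estimate needs an argument: the truncated sums bound the
    integral of the nonnegative function [f + M] from below, and the upper
    estimate is the lower one for [- f]. *)
Lemma Rintegral_mixture_ge D f M n : measurable D -> (forall l, m l D = 1%E) ->
  measurable_fun D f -> (forall x, D x -> `|f x| <= M) ->
  \sum_(l < n) dyadic l * \int[m l]_(x in D) f x - M * (2^-1) ^+ n <=
  \int[mixture]_(x in D) f x.
Proof.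
move=> mD D1 mf fM.
have mfM : measurable_fun D (fun x => 1 * f x + M).
  by apply: measurable_funD => //; exact: measurable_funM.
have f0 x : D x -> 0 <= 1 * f x + M.
  move=> Dx; have := fM _ Dx; rewrite ler_norml mul1r; lra.
have key : \sum_(l < n) dyadic l * \int[m l]_(x in D) (1 * f x + M) <=
    \int[mixture]_(x in D) (1 * f x + M).
  have fin (mu : {measure set T -> \bar R}) : mu D = 1%E ->
      (\int[mu]_(x in D) (1 * f x + M)%:E)%E =
      (\int[mu]_(x in D) (1 * f x + M))%:E.
    move=> mu1; rewrite /Rintegral fineK//; apply: integrable_fin_num => //.
    apply: (@integrable_bounded _ _ _ _ _ _ (M + M)) => //.
      by rewrite mu1 ltry.
    by move=> x Dx; rewrite (le_trans (ler_normD _ _))// mul1r lerD ?fM//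
      ger0_norm// (le_trans _ (fM _ Dx)).
  rewrite -lee_fin -fin; last exact: mixture_prob.
  rewrite ge0_integral_mixture//; last exact/measurable_EFinP.
  rewrite -sumEFin; under eq_bigr do rewrite EFinM -fin//.
  rewrite -(big_mkord xpredT
    (fun l => (dyadic l)%:E * \int[m l]_(x in D) (1 * f x + M)%:E)%E).
  apply: nneseries_lim_ge => l _ _.
  by rewrite mule_ge0 ?lee_fin ?dyadic_ge0// integral_ge0.
rewrite (Rintegral_affine _ _ mD _ mf fM) in key; last exact: mixture_prob.
rewrite mul1r in key.
move: key.
under eq_bigr do rewrite (Rintegral_affine _ _ mD (D1 _) mf fM) mul1r mulrDr.
rewrite big_split/= -mulr_suml sum_dyadic mulrBl mul1r; lra.
Qed.

Lemma Rintegral_mixture_dist D f M n : measurable D -> (forall l, m l D = 1%E) ->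
  measurable_fun D f -> (forall x, D x -> `|f x| <= M) ->
  `|\int[mixture]_(x in D) f x - \sum_(l < n) dyadic l * \int[m l]_(x in D) f x|
  <= M * (2^-1) ^+ n.
Proof.
move=> mD D1 mf fM.
have h1 := Rintegral_mixture_ge n mD D1 mf fM.
have neg (mu : {measure set T -> \bar R}) : mu D = 1%E ->
    \int[mu]_(x in D) (- f x) = - \int[mu]_(x in D) f x.
  move=> mu1; rewrite -[RHS]addr0 -mulN1r -(Rintegral_affine _ _ mD mu1 mf fM).
  by apply: eq_Rintegral => x _; rewrite mulN1r addr0.
have mNf : measurable_fun D (fun x => - f x) by apply: measurableT_comp.
have NfM x : D x -> `|- f x| <= M by rewrite normrN; exact: fM.
have := Rintegral_mixture_ge n mD D1 mNf NfM.
rewrite neg; last exact: mixture_prob.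
under eq_bigr do rewrite neg// mulrN.
by rewrite sumrN ler_norml; lra.
Qed.

End mixture.

(** * Integrals and distribution functions *)

(** Counting the levels [a * k] below [y] recovers [y] up to one step [a]. *)
Lemma staircase (R : realDomainType) (a y : R) n : 0 <= a -> 0 <= y <= a *+ n ->
  \sum_(k < n) a * (a *+ k.+1 <= y)%R%:R <= y <=
  \sum_(k < n) a * (a *+ k.+1 <= y)%R%:R + a.
Proof.
move=> a0; elim: n y => [|n ih] y /andP[y0 yn].
  by rewrite big_ord0 y0 add0r; move: yn; rewrite mulr0n; lra.
rewrite big_ord_recl/= mulr1n; case: (leP a y) => ay.
  under eq_bigr do rewrite /bump add1n mulrS -lerBrDl.
  have := ih (y - a); rewrite mulr1 => /(_ _)/andP[|h1 h2].
    by move: yn; rewrite mulrS; lra.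
  by apply/andP; split; move: h1 h2; lra.
rewrite big1 ?mulr0 ?add0r ?y0 ?(ltW ay)// => i _.
rewrite (_ : (_ <= y) = false) ?mulr0//; apply/negbTE; rewrite -ltNge.
by apply: (lt_le_trans ay); rewrite mulrS lerDl mulrn_wge0.
Qed.

Section distribution.
Context (R : realType).

Lemma integral_staircase d (T : measurableType d)
    (mu : {measure set T -> \bar R}) (D : set T) (g : T -> R) (a : R) n :
  measurable D -> measurable_fun D g -> 0 <= a ->
  (\int[mu]_(x in D) (\sum_(k < n) a * (a *+ k.+1 <= g x)%R%:R)%:E =
   \sum_(k < n) a%:E * mu (D `&` [set x | (a *+ k.+1 <= g x)%R]))%E.
Proof.
move=> mD mg a0.
have mB k : measurable (D `&` [set x | (a *+ k.+1 <= g x)%R]).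
  by have := mg mD `[a *+ k.+1, +oo[%classic (measurable_itv _); rewrite set_itvcy.
transitivity (\int[mu]_(x in D) \sum_(k < n)
    (a%:E * (\1_(D `&` [set x | (a *+ k.+1 <= g x)%R]) x)%:E))%E.
  apply: eq_integral => x xD; rewrite -sumEFin; apply: eq_bigr => k _.
  rewrite -EFinM indicE; congr (a * _%:R)%:E; congr nat_of_bool.
  by rewrite in_setI xD/=; apply/idP/idP; rewrite inE.
rewrite ge0_integral_sum//.
- apply: eq_bigr => k _; rewrite ge0_integralZl_EFin//.
  + by rewrite integral_indic// setIAC setIid.
  + by apply/measurable_EFinP; exact: measurable_indic.
- move=> k; apply/measurable_EFinP; apply: measurable_funM => //.
- by move=> k x _; rewrite mule_ge0 ?lee_fin.
Qed.

Lemma le_integral_distribution d1 (T1 : measurableType d1)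
    d2 (T2 : measurableType d2)
    (mu1 : {measure set T1 -> \bar R}) (mu2 : {measure set T2 -> \bar R})
    (D1 : set T1) (D2 : set T2) (g1 : T1 -> R) (g2 : T2 -> R) (M e : R) :
  measurable D1 -> measurable D2 -> mu1 D1 = 1%E ->
  measurable_fun D1 g1 -> measurable_fun D2 g2 ->
  (forall x, D1 x -> 0 <= g1 x <= M) -> (forall x, D2 x -> 0 <= g2 x <= M) ->
  0 <= M -> 0 <= e ->
  (forall a, (mu1 (D1 `&` [set x | (a <= g1 x)%R]) <=
              mu2 (D2 `&` [set x | (a <= g2 x)%R]) + e%:E)%E) ->
  (\int[mu1]_(x in D1) (g1 x)%:E <=
   \int[mu2]_(x in D2) (g2 x)%:E + (M * e)%:E)%E.
Proof.
move=> mD1 mD2 D11 mg1 mg2 g1M g2M M0 e0 H.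
apply/lee_addgt0Pr => eps eps0.
have [n Mn] : exists n : nat, M / n.+1%:R <= eps.
  have [k kM] : exists k : nat, M / eps <= k%:R.
    by exists (Num.truncn (M / eps)).+1; rewrite ltW// truncnS_gt.
  exists k; rewrite ler_pdivrMr// mulrC -ler_pdivrMr// (le_trans kM)//.
  by rewrite ler_nat.
set a := M / n.+1%:R in Mn.
have a0 : 0 <= a by rewrite divr_ge0.
have na : a *+ n.+1 = M by rewrite /a -mulr_natr divfK// pnatr_eq0.
clearbody a.
have st (y : R) : 0 <= y <= M -> _ := fun yM =>
  staircase a0 (eq_ind_r (fun z => 0 <= y <= z) yM na).
pose S d (T : measurableType d) (g : T -> R) x :=
  \sum_(k < n.+1) a * (a *+ k.+1 <= g x)%R%:R.
have S0 d (T : measurableType d) (g : T -> R) x : 0 <= S d T g x.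
  by apply: sumr_ge0 => k _; rewrite mulr_ge0.
have mS d (T : measurableType d) (g : T -> R) D : measurable D ->
    measurable_fun D g -> measurable_fun D (S d T g).
  move=> mD mg; apply: measurable_sum => k; apply: measurable_funM => //.
  rewrite (_ : (fun x => _) = fun x => if (a *+ k.+1 <= g x)%R then 1 else 0).
    apply: measurable_fun_if => //; exact: measurable_fun_ler.
  by apply/funext => x; case: ifP.
apply: (@le_trans _ _ (\int[mu1]_(x in D1) ((S _ _ g1 x)%:E + a%:E))%E).
  apply: ge0_le_integral => //.
  - by move=> x Dx; rewrite lee_fin; case/andP: (g1M x Dx).
  - exact/measurable_EFinP.
  - by apply: emeasurable_funD => //; apply/measurable_EFinP; exact: mS.
  - by move=> x Dx; rewrite lee_fin; case/andP: (st _ (g1M x Dx)).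
rewrite ge0_integralD//; last 2 first.
- by move=> x _; rewrite lee_fin S0.
- by apply/measurable_EFinP; exact: mS.
rewrite integral_cst// D11 mule1; apply: leeD; last by rewrite lee_fin.
rewrite integral_staircase//.
apply: (@le_trans _ _ (\sum_(k < n.+1) (a%:E *
    (mu2 (D2 `&` [set x | (a *+ k.+1 <= g2 x)%R])) + (a * e)%:E))%E).
  apply: lee_sum => k _; rewrite EFinM -muleDr//.
  - by apply: lee_wpmul2l; rewrite ?lee_fin.
  - by rewrite ge0_adde_def// inE.
rewrite big_split/= -integral_staircase//; apply: leeD.
  apply: ge0_le_integral => //.
  - by move=> x _; rewrite lee_fin; exact: S0.
  - by apply/measurable_EFinP; exact: mS.
  - exact/measurable_EFinP.
  - by move=> x Dx; rewrite lee_fin; case/andP: (st _ (g2M x Dx)).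
by rewrite sumEFin lee_fin sumr_const card_ord -mulrnAl na.
Qed.

(** Two probability measures that nearly agree on the superlevel sets of two
    functions nearly agree on their integrals: approximate the functions by the
    staircases of their superlevel sets. *)
Lemma le_Rintegral_distribution d1 (T1 : measurableType d1)
    d2 (T2 : measurableType d2)
    (mu1 : {measure set T1 -> \bar R}) (mu2 : {measure set T2 -> \bar R})
    (D1 : set T1) (D2 : set T2) (g1 : T1 -> R) (g2 : T2 -> R) (M e : R) :
  measurable D1 -> measurable D2 -> mu1 D1 = 1%E -> mu2 D2 = 1%E ->
  measurable_fun D1 g1 -> measurable_fun D2 g2 ->
  (forall x, D1 x -> `|g1 x| <= M) -> (forall x, D2 x -> `|g2 x| <= M) ->
  0 <= M -> 0 <= e ->
  (forall a, (mu1 (D1 `&` [set x | (a <= g1 x)%R]) <=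
              mu2 (D2 `&` [set x | (a <= g2 x)%R]) + e%:E)%E) ->
  \int[mu1]_(x in D1) g1 x <= \int[mu2]_(x in D2) g2 x + 2 * M * e.
Proof.
move=> mD1 mD2 D11 D21 mg1 mg2 g1M g2M M0 e0 H.
have shift d (T : measurableType d) (mu : {measure set T -> \bar R}) D (g : T -> R) :
    measurable D -> mu D = 1%E -> measurable_fun D g ->
    (forall x, D x -> `|g x| <= M) ->
    (\int[mu]_(x in D) (1 * g x + M)%:E)%E = (\int[mu]_(x in D) g x + M)%:E.
  move=> mD D_1 mg gM.
  have := Rintegral_affine 1 M mD D_1 mg gM; rewrite mul1r => <-.
  rewrite /Rintegral fineK//; apply: integrable_fin_num => //.
  apply: (@integrable_bounded _ _ _ _ _ (fun x => 1 * g x + M) (M + M)) => //.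
  - by rewrite D_1 ltry.
  - by apply: measurable_funD => //; apply: measurable_funM.
  - move=> x Dx; rewrite (le_trans (ler_normD _ _))// mul1r lerD ?gM//.
    by rewrite ger0_norm.
have bound d (T : measurableType d) D (g : T -> R) :
    (forall x, D x -> `|g x| <= M) ->
    forall x, D x -> 0 <= 1 * g x + M <= 2 * M.
  by move=> gM x Dx; have := gM x Dx; rewrite ler_norml; lra.
have mshift d (T : measurableType d) D (g : T -> R) :
    measurable D -> measurable_fun D g ->
    measurable_fun D (fun x => 1 * g x + M).
  by move=> mD mg; apply: measurable_funD => //; apply: measurable_funM.
have lev d (T : measurableType d) (g : T -> R) a :
    [set x | a <= 1 * g x + M] = [set x | a - M <= g x].
  by apply/seteqP; split=> x /=; rewrite mul1r lerBlDr.
have M2 : 0 <= 2 * M by rewrite mulr_ge0.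
have Ha a : (mu1 (D1 `&` [set x | (a <= 1 * g1 x + M)%R]) <=
    mu2 (D2 `&` [set x | (a <= 1 * g2 x + M)%R]) + e%:E)%E.
  by rewrite !lev; exact: H.
have := le_integral_distribution mD1 mD2 D11 (mshift _ _ _ _ mD1 mg1)
  (mshift _ _ _ _ mD2 mg2) (bound _ _ _ _ g1M) (bound _ _ _ _ g2M) M2 e0 Ha.
by rewrite !shift// -EFinD lee_fin; lra.
Qed.

End distribution.

(** * Borel sets, supports and compact sets *)

Section borel.
Context (G : ptopologicalType).

Lemma open_borel (U : set G) : open U -> measurable (U : set (borel G)).
Proof. by move=> oU; apply: sub_sigma_algebra. Qed.

Lemma closed_borel (A : set G) : closed A -> measurable (A : set (borel G)).
Proof.
move=> cA; rewrite -(setCK A); apply: measurableC.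
by apply: open_borel; exact: closed_openC.
Qed.

Lemma within_continuous_borel (D : set G) (f : G -> G) :
  {within D, continuous f} ->
  measurable_fun (D : set (borel G)) (f : borel G -> borel G).
Proof.
move=> /continuousP cf mD.
apply: (@measurability _ _ (borel G) (borel G) D f open erefl _ mD).
move=> _ [U oU <-]; have /open_subspaceP[V oV VU] := cf U oU.
by rewrite setIC -VU; apply: measurableI => //; exact: open_borel.
Qed.

Lemma pair_continuous (g : G) : continuous (pair g : G -> G * G).
Proof. by move=> h; exact: (cvg_pair (cvg_cst g) cvg_id). Qed.

Lemma pair_borel (g : G) :
  measurable_fun [set: borel G] (pair g : borel G -> borel (G * G)).
Proof.
apply: (@measurability _ _ (borel G) (borel (G * G)) _ _ open) => //.
move=> _ [U oU <-]; rewrite setTI; apply: open_borel.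
by have /continuousP := @pair_continuous g; exact.
Qed.

Lemma continuous_borel_real (R : realType) (f : G -> R) : continuous f ->
  measurable_fun [set: borel G] (f : borel G -> R).
Proof.
move=> /continuousP cf.
apply: (@measurability _ _ (borel G) R _ f _ (@RGenOpens.measurableE R)).
move=> _ [_ [x [y ->]] <-]; rewrite setTI; apply: open_borel; apply: cf.
exact: interval_open.
Qed.

Lemma second_countable_seq : @second_countable G ->
  exists e : nat -> set G, (forall n, open (e n)) /\
    forall x U, open U -> U x -> exists2 n, e n x & e n `<=` U.
Proof.
move=> [B + [Bo Bb]] => /pfcard_geP[B0|[e]].
  exists (fun=> set0); split=> [_|x U oU Ux]; first exact: open0.
  have [V [BV _] _] := Bb x U (open_nbhs_nbhs (conj oU Ux)).
  by move: BV; rewrite B0.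
exists e; split=> [n|x U oU Ux]; first by apply: Bo; exact: funS.
have [V [/= BV Vx] VU] := Bb x U (open_nbhs_nbhs (conj oU Ux)).
by have [n _ en] := 'surj_e BV; exists n; rewrite en.
Qed.

(** Keep the basic open sets that are contained in a compact set. *)
Lemma compact_exhaustion : @second_countable G -> locally_compact [set: G] ->
  exists E : nat -> set G, [/\ forall i, compact (E i),
    forall i j, (i <= j)%N -> E i `<=` E j & forall x, exists i, E i x].
Proof.
move=> /second_countable_seq[e [eo eb]] lc.
have /choice[K KP] : forall n, exists K, compact K /\
    ((exists2 K', compact K' & e n `<=` K') -> e n `<=` K).
  move=> n.
  have [[K' cK' eK']|no] := pselect (exists2 K', compact K' & e n `<=` K').
    by exists K'.
  by exists set0; split=> [|/no//]; exact: compact0.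
exists (fun i => \big[setU/set0]_(k < i) K k); split.
- by move=> i; apply: bigsetU_compact => k _; case: (KP k).
- by move=> i j ij; exact: subset_bigsetU.
- move=> x; have [V /= Vx [cV _]] := lc x I.
  move: Vx; rewrite withinET nbhsE => -[U [oU Ux] UV].
  have [n enx enU] := eb x U oU Ux.
  exists n.+1; rewrite big_ord_recr/=; right.
  apply: (KP n).2 => //; exists V => //; exact: subset_trans UV.
Qed.

(** A point outside the support has a null basic open neighbourhood, and there
    are only countably many of these. *)
Lemma support_negligible (R : realType)
    (mu : {measure set (borel G) -> \bar R}) : @second_countable G ->
  mu.-negligible (~` measure_support mu).
Proof.
move=> /second_countable_seq[e [eo eb]].
pose F n := if mu (e n) == 0%E then e n else set0.
apply: (@negligibleS _ _ _ mu (\bigcup_n F n)).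
  move=> x /existsNP[U /not_implyP[[oU Ux]]].
  rewrite lt0e => /negP; rewrite negb_and negbK measure_ge0 orbF => /eqP U0.
  have [n enx enU] := eb x U oU Ux; exists n => //; rewrite /F.
  suff -> : mu (e n) = 0%E by rewrite eqxx.
  exact: (subset_measure0 (open_borel (eo n)) (open_borel oU) enU U0).
apply: negligible_bigcup => n; rewrite /F; case: ifPn => [/eqP en0|_].
  by apply/negligibleP => //; exact: open_borel.
exact: negligible_set0.
Qed.

End borel.

(** * Mixtures of systems of measures *)

Lemma expr_small (R : archiRealFieldType) (c e : R) : 0 <= c < 1 -> 0 < e ->
  exists n, c ^+ n <= e.
Proof.
move=> /andP[c0 c1] e0.
have /cvgrPdist_le/(_ e e0)[n _ /(_ n (leqnn n))] : c ^+ n @[n --> \oo] --> 0.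
  by apply: cvg_expr; rewrite ger0_norm.
by rewrite sub0r normrN ger0_norm ?exprn_ge0//; exists n.
Qed.

Lemma half_lt1 (R : realFieldType) : 0 <= (2^-1 : R) < 1.
Proof. by rewrite invr_ge0 ler0n invf_lt1// ltr1n. Qed.

Lemma half_le1 (R : realFieldType) : (2^-1 : R) <= 1.
Proof. by case/andP: (half_lt1 R) => _ /ltW. Qed.

Section complex_convergence.
Context (R : realType).

Lemma cvg_complexP T (F : set_system T) (f : T -> R[i]) (l : R[i]) :
  Filter F ->
  (f : T -> R[i]^o) @ F --> (l : R[i]^o) <->
  (fun t => complex.Re (f t)) @ F --> complex.Re l /\
  (fun t => complex.Im (f t)) @ F --> complex.Im l.
Proof.
move=> FF.
have norm_Re (z : R[i]) : (`|complex.Re z|%:C)%C <= `|z| by exact: normc_ge_Re.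
have norm_i : `|'i%C : R[i]| = 1.
  by rewrite normc_def/= expr0n expr1n add0r sqrtr1.
have norm_Im (z : R[i]) : (`|complex.Im z|%:C)%C <= `|z|.
  by rewrite -normrN -ReiNIm (le_trans (norm_Re _))// normrM norm_i mulr1.
have norm_le (z : R[i]) : `|z| <= (`|complex.Re z|%:C)%C + (`|complex.Im z|%:C)%C.
  rewrite {1}[z]complexE (le_trans (ler_normD _ _))// normrM norm_i mul1r.
  by rewrite !normc_def/= !expr0n/= !addr0 !sqrtr_sqr.
have ReB (z w : R[i]) : complex.Re (z - w) = complex.Re z - complex.Re w.
  by case: z w => [? ?] [].
have ImB (z w : R[i]) : complex.Im (z - w) = complex.Im z - complex.Im w.
  by case: z w => [? ?] [].
split=> [/cvgrPdist_le fl|[/cvgrPdist_le fr /cvgrPdist_le fi]].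
  split; apply/cvgrPdist_le => e e0.
    have e0' : 0 < (e%:C)%C by rewrite ltcR.
    apply: filterS (fl _ e0') => t ft.
    by rewrite -lecR -ReB (le_trans (norm_Re _)).
  have e0' : 0 < (e%:C)%C by rewrite ltcR.
  apply: filterS (fl _ e0') => t ft.
  by rewrite -lecR -ImB (le_trans (norm_Im _)).
apply/cvgrPdist_le => -[e i]; rewrite ltcE/= => /andP[/eqP -> e0].
have e2 : 0 < e / 2 by rewrite divr_gt0.
apply: filterS2 (fr _ e2) (fi _ e2) => t ftr fti.
rewrite (le_trans (norm_le _))// ReB ImB -rmorphD/=.
by rewrite -[Complex e 0]/((e%:C)%C) lecR (splitr e) lerD.
Qed.

Lemma continuous_complexP (X : topologicalType) (f : X -> R[i]) :
  continuous (f : X -> R[i]^o) <->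
  continuous (fun t => complex.Re (f t)) /\
  continuous (fun t => complex.Im (f t)).
Proof.
split=> [cf|[cr ci] x]; last by apply/cvg_complexP; split; [exact: cr|exact: ci].
by split=> x; have /cvg_complexP[] := cf x.
Qed.

Lemma within_continuous_approx (X : topologicalType) (A : set X)
    (h : X -> R) (hn : nat -> X -> R) :
  (forall n, {within A, continuous (hn n)}) ->
  (forall e, 0 < e -> exists n, forall x, A x -> `|h x - hn n x| <= e) ->
  {within A, continuous h}.
Proof.
move=> chn H; apply/subspace_continuousP => x Ax; apply/cvgrPdist_le => e e0.
have e3 : 0 < e / 3 by rewrite divr_gt0.
have [n hhn] := H _ e3.
have /subspace_continuousP/(_ x Ax)/cvgrPdist_le/(_ _ e3) := chn n.
apply: filterS2 (withinT _ _) => y Ay hxy.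
have := hhn _ Ax; have := hhn _ Ay; move: hxy.
rewrite /from_subspace !ler_norml; lra.
Qed.

Lemma compact_support_bounded (X : topologicalType) (K : set X) (g : X -> R) :
  compact K -> continuous g -> (forall x, ~ K x -> g x = 0) ->
  exists M, forall x, `|g x| <= M.
Proof.
move=> cK cg g0; have /compact_bounded[M [_ HM]] : compact (g @` K).
  by apply: continuous_compact => //; exact: continuous_subspaceT.
exists (`|M| + 1) => x; have [Kx|/g0 ->] := pselect (K x).
  by apply: HM; [rewrite ltr_pwDr// ler_norm|exists x].
by rewrite normr0 addr_ge0.
Qed.

End complex_convergence.

Section mixture_radon.
Context (R : realType) (G : ptopologicalType).
Variable m : nat -> {measure set (borel G) -> \bar R}.
Hypothesis m1 : forall l, m l [set: G] = 1%E.

Let prob_fin (mu : {measure set (borel G) -> \bar R}) (A : set (borel G)) :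
  mu [set: G] = 1%E -> measurable A -> mu A \is a fin_num.
Proof.
move=> mu1 mA; rewrite ge0_fin_numE// (@le_lt_trans _ _ 1%E) ?ltry//.
by rewrite -mu1 le_measure ?inE//; exact: measurableT.
Qed.

Let mixture1 : mixture m [set: G] = 1%E.
Proof. exact: mixture_prob. Qed.

(** Only finitely many components matter up to a small error: this is what makes
    the regularity of the components pass to the mixture. *)
Lemma le_mixture (A B : set (borel G)) (e : R) n :
  measurable A -> measurable B -> 0 <= e ->
  (forall l, (l < n)%N -> (m l A <= m l B + e%:E)%E) ->
  (mixture m A <= mixture m B + (e + 2 * (2^-1) ^+ n)%:E)%E.
Proof.
move=> mA mB e0 AB.
have dist (C : set (borel G)) : measurable C ->
    `|fine (mixture m C) - \sum_(l < n) dyadic R l * fine (m l C)| <=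
    (2^-1) ^+ n.
  move=> mC.
  have mI : measurable_fun [set: borel G] (\1_C : borel G -> R).
    exact: measurable_indic.
  have I1 x : [set: borel G] x -> `|\1_C x : R| <= 1.
    by move=> _; rewrite indicE; case: (_ \in _); rewrite ?normr1 ?normr0.
  have := Rintegral_mixture_dist n measurableT m1 mI I1.
  rewrite mul1r /Rintegral integral_indic// setIT.
  by under eq_bigr do rewrite integral_indic// setIT.
rewrite -(fineK (prob_fin mixture1 mA)) -(fineK (prob_fin mixture1 mB)).
rewrite -EFinD lee_fin.
have : \sum_(l < n) dyadic R l * fine (m l A) <=
       \sum_(l < n) dyadic R l * fine (m l B) + e.
  apply: (@le_trans _ _ (\sum_(l < n) (dyadic R l * fine (m l B) + dyadic R l * e))).
    apply: ler_sum => l _; rewrite -mulrDr; apply: ler_wpM2l.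
      exact: dyadic_ge0.
    rewrite -lee_fin EFinD (fineK (prob_fin (m1 l) mA)).
    by rewrite (fineK (prob_fin (m1 l) mB)) AB.
  rewrite big_split/= lerD2l -mulr_suml sum_dyadic.
  by rewrite ler_piMl// lerBlDr lerDl exprn_ge0.
by have := dist _ mA; have := dist _ mB; rewrite !ler_norml; lra.
Qed.

Lemma mixture_radon : hausdorff_space G ->
  (forall l, radon_measure (m l)) -> radon_measure (mixture m).
Proof.
move=> hG mr.
have small (e : R) : 0 < e -> exists n, 2 * (2^-1) ^+ n <= e / 2.
  move=> e0; have e4 : 0 < e / 4 by rewrite divr_gt0.
  by have [n hn] := expr_small (half_lt1 R) e4; exists n; lra.
split=> [K cK|A mA|U oU].
- rewrite (@le_lt_trans _ _ 1%E) ?ltry// -mixture1 le_measure ?inE//.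
  by apply: closed_borel; exact: compact_closed.
- apply/eqP; rewrite eq_le; apply/andP; split.
    apply: le_ereal_inf_tmp => _ [U [oU AU] <-].
    by rewrite le_measure ?inE//; exact: open_borel.
  apply/lee_addgt0Pr => e e0; have [n hn] := small e e0.
  have e2 : 0 < e / 2 by rewrite divr_gt0.
  have [U [oU AU mU]] : exists U : set G, [/\ open U, A `<=` U &
      forall l, (l < n)%N -> (m l U <= m l A + (e / 2)%:E)%E].
    elim: n {hn} => [|n [U [oU AU mU]]].
      by exists setT; split => //; exact: openT.
    have finA := prob_fin (m1 n) mA.
    rewrite (radon_outer (mr n) mA) in finA.
    have [_ [V [oV AV] <-]] := lb_ereal_inf_adherent e2 finA.
    rewrite -(radon_outer (mr n) mA) => /ltW mV.
    exists (U `&` V); split; [exact: openI|by rewrite subsetI|].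
    have mUV : measurable (U `&` V : set (borel G)).
      by apply: open_borel; exact: openI.
    move=> l; rewrite ltnS leq_eqVlt => /predU1P[->|ln].
      by rewrite (le_trans _ mV)// le_measure ?inE//; exact: open_borel.
    by rewrite (le_trans _ (mU l ln))// le_measure ?inE//; exact: open_borel.
  apply: (@le_trans _ _ (mixture m U)); first by apply: ereal_inf_lbound; exists U.
  apply: (le_trans (le_mixture (open_borel oU) mA (ltW e2) mU)).
  by rewrite leeD2l// lee_fin; lra.
- apply/eqP; rewrite eq_le; apply/andP; split; last first.
    apply: ge_ereal_sup => _ [K [cK KU] <-].
    rewrite le_measure ?inE//; last exact: open_borel.
    by apply: closed_borel; exact: compact_closed.
  apply/lee_addgt0Pr => e e0; have [n hn] := small e e0.
  have e2 : 0 < e / 2 by rewrite divr_gt0.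
  have mU := open_borel oU.
  have cm (K : set G) : compact K -> measurable (K : set (borel G)).
    by move=> cK; apply: closed_borel; exact: compact_closed.
  have [K [cK KU mK]] : exists K : set G, [/\ compact K, K `<=` U &
      forall l, (l < n)%N -> (m l U <= m l K + (e / 2)%:E)%E].
    elim: n {hn} => [|n [K [cK KU mK]]].
      by exists set0; split => //; exact: compact0.
    have finU := prob_fin (m1 n) mU.
    rewrite (radon_inner (mr n) oU) in finU.
    have [_ [L [cL LU] <-]] := ub_ereal_sup_adherent e2 finU.
    rewrite -(radon_inner (mr n) oU) lteBlDr// => /ltW mL.
    have cKL : compact (K `|` L) by exact: compactU.
    exists (K `|` L); split => //; first by rewrite subUset.
    move=> l; rewrite ltnS leq_eqVlt => /predU1P[->|ln].
      by rewrite (le_trans mL)// leeD2r// le_measure ?inE//; exact: cm.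
    by rewrite (le_trans (mK l ln))// leeD2r// le_measure ?inE//; exact: cm.
  apply: (le_trans (le_mixture mU (cm _ cK) (ltW e2) mK)).
  apply: leeD; first by apply: ereal_sup_ubound; exists K.
  by rewrite lee_fin; lra.
Qed.

End mixture_radon.

Section mixture_system.
Context (R : realType) (G : ptopologicalType) (C : semigroupoid G).
Variables (lambda : measure_family R G) (theta : nat -> measure_family R G).
Hypothesis hG : hausdorff_space G.
Hypothesis theta_ad : forall l, adapted C lambda (theta l).

Definition mixture_system : measure_family R G :=
  fun x => mixture (fun l => theta l x).

Let theta1 x l : sg_units C x -> theta l x [set: G] = 1%E.
Proof. exact: (ad_probability (theta_ad l)). Qed.

(** The integrals against the truncated mixtures are continuous in the unit and
    converge uniformly. *)
Lemma mixture_system_continuous (f : G -> R[i]) : Cc f ->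
  {within sg_units C, continuous
    (fun x => cintegral (mixture_system x) [set: G] f : R[i]^o)}.
Proof.
move=> ccf; have [/continuous_complexP[cr ci] cK] := ccf.
have real_part (g : G -> R) : continuous g ->
    (forall x, f x = 0 -> g x = 0) ->
    (forall l, {within sg_units C, continuous
      (fun x => \int[theta l x]_(y in [set: G]) g y)}) ->
    {within sg_units C, continuous
      (fun x => \int[mixture_system x]_(y in [set: G]) g y)}.
  move=> cg fg cl; have [M gM] : exists M, forall x, `|g x| <= M.
    apply: (compact_support_bounded cK cg) => x Kx; apply: fg.
    by apply: contra_notP Kx => /eqP fx; exact: subset_closure.
  have mg := continuous_borel_real cg.
  apply: (within_continuous_approx (hn := fun n x =>
    \sum_(l < n) dyadic R l * \int[theta l x]_(y in [set: G]) g y)).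
    elim=> [|n ih].
      by under eq_fun do rewrite big_ord0; move=> x; exact: cvg_cst.
    under eq_fun do rewrite big_ord_recr/=.
    move=> x; apply: (cvgD (ih x)); apply: cvgMr.
    exact: cl.
  move=> e e0.
  have eM : 0 < e / (`|M| + 1) by rewrite divr_gt0// ltr_wpDl.
  have [n hn] := expr_small (half_lt1 R) eM; exists n => x Ux.
  have gM' y : [set: borel G] y -> `|g y| <= M by move=> _; exact: gM.
  apply: le_trans (Rintegral_mixture_dist n measurableT
    (fun l => theta1 l Ux) mg gM') _.
  move: hn; rewrite ler_pdivlMr ?ltr_wpDl// => hn.
  apply: le_trans hn; rewrite mulrC ler_wpM2l ?exprn_ge0//.
  by rewrite (le_trans (ler_norm _))// lerDl.
have cRI l : {within sg_units C, continuous
      (fun x => \int[theta l x]_(y in [set: G]) complex.Re (f y))} /\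
    {within sg_units C, continuous
      (fun x => \int[theta l x]_(y in [set: G]) complex.Im (f y))}.
  exact: (continuous_complexP _).1 (cs_continuous (ad_system (theta_ad l)) ccf).
apply/continuous_complexP; split.
- by apply: real_part => // [x ->//|l]; have [] := cRI l.
- by apply: real_part => // [x ->//|l]; have [] := cRI l.
Qed.

Lemma mixture_borel_derivative : borel_derivative C mixture_system lambda.
Proof.
have /choice[D DP] := fun l => ad_borel (theta_ad l).
exists (fun p => (\sum_(l <oo) (dyadic R l)%:E * D l p)%E); split.
- apply: ge0_emeasurable_sum => [l p _ _|l _].
    by have [_ D0 _] := DP l; rewrite mule_ge0// lee_fin dyadic_ge0.
  by have [mD _ _] := DP l; exact: measurable_funeM.
- move=> p; apply: nneseries_ge0 => l _ _.
  by have [_ D0 _] := DP l; rewrite mule_ge0// lee_fin dyadic_ge0.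
- move=> g A mA.
  have mg := @pair_borel G g.
  rewrite integral_nneseries//; last 2 first.
  + move=> l; have [mD _ _] := DP l.
    apply: (@measurable_funS _ _ _ _ setT) => //.
    by apply: measurable_funeM; exact: (measurableT_comp mD mg).
  + by move=> l x _; have [_ D0 _] := DP l; rewrite mule_ge0// lee_fin dyadic_ge0.
  rewrite /translate mixtureE; apply: eq_eseriesr => l _.
  have [mD D0 DE] := DP l; rewrite ge0_integralZl_EFin ?dyadic_ge0//.
    by rewrite -DE.
  apply: (@measurable_funS _ _ _ _ setT) => //; exact: (measurableT_comp mD mg).
Qed.

(** A mixture of adapted systems is again adapted: continuity survives because
    the mixture converges uniformly, and the derivatives are added. *)
Lemma mixture_system_adapted : adapted C lambda mixture_system.
Proof.
have sys l := ad_system (theta_ad l).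
split; last exact: mixture_borel_derivative.
- split.
  + by move=> x Ux; apply: mixture_null => l; exact: (cs_fiber (sys l)).
  + by move=> x Ux; rewrite mixture_prob => [/eqP|l];
      [rewrite onee_eq0|exact: theta1].
  + move=> x Ux; exists (fun=> setT); first by rewrite bigcup_const.
    by move=> _; rewrite mixture_prob ?ltry// => l; exact: theta1.
  + move=> x Ux; apply: mixture_radon => // l; first exact: theta1.
    exact: (cs_radon (sys l)).
  + exact: mixture_system_continuous.
- by move=> x Ux; apply: mixture_prob => l; exact: theta1.
- move=> x Ux A lA B mB BA; apply: mixture_null => l.
  exact: (ad_dominated (theta_ad l) Ux lA mB BA).
Qed.

End mixture_system.

(** * Compact sets of translates and the choice of the components *)

Section translates.
Context (R : realType) (G : ptopologicalType) (C : semigroupoid G).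
Hypothesis GC : locally_compact_semigroupoid C.
Implicit Types (K S : set G) (theta : nat -> measure_family R G).

Let hG : hausdorff_space G := lc_hausdorff GC.
Let tC : topological_semigroupoid C := lc_topological GC.

Lemma fiber_closed x : closed (fiber C x).
Proof.
apply: closed_comp => [y _|]; first exact: (tgt_continuous tC).
exact/accessible_closed_set1/hausdorff_accessible.
Qed.

Lemma composable_closed : closed (composable C).
Proof.
move=> p clp; apply: hG => A B nA nB.
have nAB : nbhs p [set q | A (src C q.1) /\ B (tgt C q.2)].
  apply: filterI.
    have c1 : (fun q : G * G => src C q.1) @ p --> src C p.1.
      apply: (@continuous_comp _ _ _ fst (src C)); first exact: cvg_fst.
      exact: (src_continuous tC).
    exact: c1.
  have c2 : (fun q : G * G => tgt C q.2) @ p --> tgt C p.2.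
    apply: (@continuous_comp _ _ _ snd (tgt C)); first exact: cvg_snd.
    exact: (tgt_continuous tC).
  exact: c2.
have [q [qc [Aq Bq]]] := clp _ nAB.
by exists (src C q.1); split=> //; rewrite qc.
Qed.

Lemma sg_mul_borel z :
  measurable_fun (fiber C (src C z) : set (borel G))
    (sg_mul C z : borel G -> borel G).
Proof.
apply: within_continuous_borel; apply/continuousP => U oU; apply/open_subspaceP.
have /continuousP/(_ U oU)/open_subspaceP[V oV VU] := sg_mul_continuous tC.
exists [set h | V (z, h)].
  by have /continuousP := @pair_continuous G z; exact.
apply/seteqP; split=> h [] /= Vh ht; split=> //.
  have [] : (V `&` composable C) (z, h) by split.
  by move=> _ _; have : (V `&` composable C) (z, h) by []; rewrite VU => -[].
have : ((fun p : G * G => sg_mul C p.1 p.2) @^-1` U `&` composable C) (z, h).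
  by split.
by rewrite -VU => -[].
Qed.

Definition translates K S : set G :=
  [set sg_mul C p.1 p.2 | p in (K `*` S) `&` composable C].

Lemma translates_compact K S : compact K -> compact S ->
  compact (translates K S).
Proof.
move=> cK cS; apply: continuous_compact.
  apply: continuous_subspaceW (sg_mul_continuous tC).
  exact: subIsetr.
by apply: compact_closedI composable_closed; exact: compact_setX.
Qed.

Section grow.
Variable theta : nat -> measure_family R G.
Hypothesis theta_tight : forall (n : nat) K, K `<=` sg_units C -> compact K ->
  compact (supp_on K (theta n)).

(** One step of the random walk with increments in [theta n], [n \in s], leads
    from [K] to [grow s K]. *)
Definition grow (s : seq nat) K : set G :=
  K `|` \big[setU/set0]_(n <- s) translates K (supp_on (src C @` K) (theta n)).

Lemma grow_compact s K : compact K -> compact (grow s K).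
Proof.
move=> cK; apply: compactU => //; apply: bigsetU_compact => n _.
apply: translates_compact => //; apply: theta_tight.
  by move=> _ [z _ <-]; exact: src_src.
apply: continuous_compact => //; apply: continuous_subspaceT.
exact: (src_continuous tC).
Qed.

Lemma iter_grow_compact s m K : compact K -> compact (iter m (grow s) K).
Proof. by move=> cK; elim: m => //= m; exact: grow_compact. Qed.

Lemma sub_iter_grow s m K : K `<=` iter m (grow s) K.
Proof. by elim: m => [//|m ih] z /ih Kz; left. Qed.

Lemma grow_mul s K n z h : n \in s -> K z -> fiber C (src C z) h ->
  measure_support (theta n (src C z)) h -> grow s K (sg_mul C z h).
Proof.
move=> ns Kz hz sh; right; rewrite -bigcup_seq; exists n => //.
exists (z, h) => //; split=> //=; split=> //=.
by apply: subset_closure; exists (src C z) => //; exists z.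
Qed.

End grow.

(** The next index is chosen once the previous ones are known: the Reiter
    property provides for it a system that is almost invariant under every
    compact set reached, in a prescribed number of steps, by the previous
    ones. *)
Lemma select_components theta (E : nat -> set G) (depth : nat -> nat) :
  (forall n K, K `<=` sg_units C -> compact K ->
    compact (supp_on K (theta n))) ->
  (forall K : set G, compact K -> forall e : R, 0 < e ->
    \forall n \near \oo, forall g, K g ->
      (total_variation_norm (fun A =>
         theta n (tgt C g) A - translate C g (theta n (src C g)) A)%E <= e%:E)%E) ->
  (forall i, compact (E i)) ->
  exists u : nat -> nat, forall i j, (i <= j)%N ->
    forall g, iter (depth i) (grow theta (mkseq u i)) (E i) g ->
      (total_variation_norm (fun A =>
         theta (u j) (tgt C g) A - translate C g (theta (u j) (src C g)) A)%E
       <= ((2^-1) ^+ j)%:E)%E.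
Proof.
move=> tight reiter cE.
pose reach s := iter (depth (size s)) (grow theta s) (E (size s)).
pose good n e g := (total_variation_norm (fun A =>
  theta n (tgt C g) A - translate C g (theta n (src C g)) A)%E <= e%:E)%E.
have /choice[next nextP] : forall s : seq nat, exists n, forall i,
    (i <= size s)%N -> forall g, reach (take i s) g ->
    good n ((2^-1) ^+ size s) g.
  move=> s.
  have cK : compact (\big[setU/set0]_(i < (size s).+1) reach (take i s)).
    by apply: bigsetU_compact => i _; exact: iter_grow_compact.
  have e0 : 0 < (2^-1) ^+ size s :> R by rewrite exprn_gt0.
  have [n _ nP] := reiter _ cK _ e0; exists n => i si g rg.
  apply: (nP n (leqnn n)).
  by rewrite -(bigcup_mkord _ (fun i => reach (take i s))); exists i.
pose st := fix st n := if n is n'.+1 then rcons (st n') (next (st n')) else [::].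
pose u n := next (st n).
have stE n : st n = mkseq u n.
  by elim: n => [//|n ih]; rewrite mkseqS -ih.
have take_mkseq i j : (i <= j)%N -> take i (mkseq u j) = mkseq u i.
  by move=> ij; rewrite /mkseq -map_take take_iota (minn_idPl ij).
exists u => i j ij g rg.
have := nextP (st j) i; rewrite stE size_mkseq take_mkseq// => /(_ ij g).
by rewrite /good /reach !size_mkseq -(stE j); apply.
Qed.

End translates.

(** * Averages over translates *)

Section average.
Context (R : realType) (G : ptopologicalType) (C : semigroupoid G).
Hypothesis GC : locally_compact_semigroupoid C.
Variable lambda : measure_family R G.
Implicit Types (rho : measure_family R G) (f : G -> R).

Definition average rho f (z : G) : R :=
  \int[rho (src C z)]_(h in fiber C (src C z)) f (sg_mul C z h).

Lemma markov_operatorE rho (f : G -> R[i]) z :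
  markov_operator C rho f z =
  Complex (average rho (fun y => complex.Re (f y)) z)
          (average rho (fun y => complex.Im (f y)) z).
Proof. by []. Qed.

Lemma fiber_measurable x : measurable (fiber C x : set (borel G)).
Proof. by apply: closed_borel; exact: fiber_closed. Qed.

Lemma adapted_fiber rho x (A : set (borel G)) : adapted C lambda rho ->
  sg_units C x -> measurable A -> rho x (fiber C x `&` A) = rho x A.
Proof.
move=> ad Ux mA; have mF := fiber_measurable x.
have -> : rho x A = (rho x (A `&` fiber C x) + rho x (A `&` ~` fiber C x))%E.
  rewrite -measureU//; try by apply: measurableI => //; exact: measurableC.
    by rewrite -setIUr setUv setIT.
  by rewrite setIACA setICr setI0.
rewrite setIC [X in (_ + X)%E](_ : _ = 0%E) ?adde0//.
apply: (subset_measure0 _ (measurableC mF) (@subIsetr _ _ _)).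
  by apply: measurableI => //; exact: measurableC.
exact: (cs_fiber (ad_system ad) Ux).
Qed.

Lemma adapted_fiber1 rho x : adapted C lambda rho -> sg_units C x ->
  rho x (fiber C x) = 1%E.
Proof.
move=> ad Ux; rewrite -(ad_probability ad Ux) -(adapted_fiber ad Ux measurableT).
by rewrite setIT.
Qed.

Lemma unit_src z : sg_units C (src C z). Proof. exact: src_src. Qed.
Lemma unit_tgt z : sg_units C (tgt C z). Proof. exact: src_tgt. Qed.

Section bounded_function.
Variables (f : G -> R) (M : R).
Hypothesis mf : measurable_fun [set: borel G] (f : borel G -> R).
Hypothesis fM : forall y, `|f y| <= M.

Lemma measurable_translate z :
  measurable_fun (fiber C (src C z) : set (borel G))
    ((fun h => f (sg_mul C z h)) : borel G -> R).
Proof.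
exact: (measurableT_comp mf
  (@sg_mul_borel _ _ GC z)).
Qed.

Lemma average_mixture_dist (theta : nat -> measure_family R G) n z :
  (forall l, adapted C lambda (theta l)) ->
  `|average (mixture_system theta) f z -
    \sum_(l < n) dyadic R l * average (theta l) f z| <= M * (2^-1) ^+ n.
Proof.
move=> ad; apply: Rintegral_mixture_dist.
- exact: fiber_measurable.
- by move=> l; exact: adapted_fiber1 (unit_src z).
- exact: measurable_translate.
- by move=> h _; exact: fM.
Qed.

Lemma average_dist rho (a B : R) z (N : set (borel G)) : adapted C lambda rho ->
  measurable N -> rho (src C z) N = 0%E ->
  (forall h, fiber C (src C z) h -> ~ N h -> `|f (sg_mul C z h) - a| <= B) ->
  `|average rho f z - a| <= B.
Proof.
move=> ad mN N0 fB; have Uz := unit_src z.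
have mF := fiber_measurable (src C z).
have mFN : measurable (fiber C (src C z) `\` N : set (borel G)).
  exact: measurableD.
have F1 := adapted_fiber1 ad Uz.
have -> : average rho f z =
    \int[rho (src C z)]_(h in fiber C (src C z) `\` N) f (sg_mul C z h).
  have If : (rho (src C z)).-integrable (fiber C (src C z))
      (EFin \o (fun h => f (sg_mul C z h))).
    apply: (integrable_bounded (M := M)) mF _ _ _.
    - by rewrite F1 ltry.
    - exact: measurable_translate.
    - by move=> h _; exact: fM.
  by rewrite /average /Rintegral (negligible_integral mN mF If N0).
apply: Rintegral_dist => //.
- have FN0 : rho (src C z) (fiber C (src C z) `&` N) = 0%E.
    by apply: (subset_measure0 _ mN (@subIsetr _ _ _) N0); exact: measurableI.
  have Foo : (rho (src C z) (fiber C (src C z)) < +oo)%E by rewrite F1 ltry.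
  by rewrite -[RHS]sube0 -F1 -FN0; exact: measureD.
- exact: (measurable_funS mF (@subDsetl _ _ _) (@measurable_translate z)).
- by move=> h [Fh Nh]; exact: fB.
Qed.

(** The averages at [z] and at [tgt z] integrate [f] against the translate of
    [rho^(src z)] and against [rho^(tgt z)] respectively: the superlevel sets of
    the two integrands have the masses that these measures give to the
    superlevel sets of [f]. *)
Lemma average_translate_dist rho (e : R) z : adapted C lambda rho -> 0 <= e ->
  (total_variation_norm (fun A =>
     rho (tgt C z) A - translate C z (rho (src C z)) A)%E <= e%:E)%E ->
  `|average rho f z - average rho f (tgt C z)| <= 2 * M * e.
Proof.
move=> ad e0 tv; have M0 : 0 <= M by exact: le_trans (fM point).
have Us := unit_src z; have Ut := unit_tgt z.
have Us' := unit_src (tgt C z).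
have close (A : set (borel G)) : measurable A ->
    (`|rho (tgt C z) A - translate C z (rho (src C z)) A| <= e%:E)%E.
  move=> mA; apply: le_trans tv; apply: ereal_sup_ge.
  pose F (i : nat) := if i is 0%N then A else ~` A.
  exists (\sum_(i < 2) `|rho (tgt C z) (F i) -
                         translate C z (rho (src C z)) (F i)|)%E.
    exists 2%N, F; split=> //.
    - by case=> [//|n]; exact: measurableC.
    - move=> [|[|//]] [|[|//]] //= _ _ [y []] //.
    - by apply/seteqP; split=> // y _; have [Ay|nAy] := pselect (A y);
        [exists 0%N|exists 1%N].
  by rewrite big_ord_recl leeDl// sume_ge0.
have mlev a : measurable ([set y | a <= f y] : set (borel G)).
  have := mf measurableT (measurable_itv `[a, +oo[).
  by rewrite set_itvcy setTI.
have lev_s a : rho (src C z)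
    (fiber C (src C z) `&` [set h | a <= f (sg_mul C z h)]) =
    translate C z (rho (src C z)) [set y | a <= f y].
  by [].
have lev_t a : rho (src C (tgt C z))
    (fiber C (src C (tgt C z)) `&` [set h | a <= f (sg_mul C (tgt C z) h)]) =
    rho (tgt C z) [set y | a <= f y].
  rewrite src_tgt -(adapted_fiber ad Ut (mlev a)); congr (rho _ _).
  by apply/seteqP; split=> h /= [th] ah; split => //;
    move: ah; rewrite -{1}th mul_tgt.
have fin_t a : rho (tgt C z) [set y | a <= f y] \is a fin_num.
  rewrite ge0_fin_numE// (@le_lt_trans _ _ 1%E) ?ltry//.
  by rewrite -(ad_probability ad Ut) le_measure ?inE.
have fin_s a : translate C z (rho (src C z)) [set y | a <= f y] \is a fin_num.
  rewrite ge0_fin_numE ?measure_ge0// (@le_lt_trans _ _ 1%E) ?ltry//.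
  rewrite -(ad_probability ad Us) le_measure ?inE//.
  have := @measurable_translate z (fiber_measurable (src C z))
    _ (measurable_itv `[a, +oo[).
  by rewrite set_itvcy.
have ts a := close _ (mlev a).
have := le_Rintegral_distribution
  (mu1 := rho (src C z)) (mu2 := rho (src C (tgt C z)))
  (fiber_measurable (src C z)) (fiber_measurable (src C (tgt C z)))
  (adapted_fiber1 ad Us) (adapted_fiber1 ad Us')
  (@measurable_translate z) (@measurable_translate (tgt C z))
  (fun h _ => fM _) (fun h _ => fM _) M0 e0.
have := le_Rintegral_distribution
  (mu2 := rho (src C z)) (mu1 := rho (src C (tgt C z)))
  (fiber_measurable (src C (tgt C z))) (fiber_measurable (src C z))
  (adapted_fiber1 ad Us') (adapted_fiber1 ad Us)
  (@measurable_translate (tgt C z)) (@measurable_translate z)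
  (fun h _ => fM _) (fun h _ => fM _) M0 e0.
rewrite -/(average rho f z) -/(average rho f (tgt C z)) => h1 h2.
have {}h1 := h1 _; have {}h2 := h2 _.
rewrite ler_norml; apply/andP; split.
  rewrite lerNl opprB lerBlDr addrC; apply: h1 => a.
  rewrite lev_s lev_t; have := ts a.
  rewrite -(fineK (fin_s a)) -(fineK (fin_t a)) -EFinB abse_EFin -EFinD !lee_fin.
  by rewrite ler_norml; lra.
rewrite lerBlDr addrC; apply: h2 => a.
rewrite lev_s lev_t; have := ts a.
rewrite -(fineK (fin_s a)) -(fineK (fin_t a)) -EFinB abse_EFin -EFinD !lee_fin.
by rewrite ler_norml; lra.
Qed.

End bounded_function.

Lemma translate_null rho z (N : set (borel G)) : adapted C lambda rho ->
  measurable N -> lambda (tgt C z) N = 0%E ->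
  translate C z (rho (src C z)) N = 0%E.
Proof.
move=> ad mN N0; have [D [mD _ ->//]] := ad_borel ad.
apply: null_set_integral => //.
by apply: measurable_funS (measurableT_comp mD (pair_borel _)).
Qed.

End average.

(** * Bounded harmonic functions of the mixture *)

Section harmonic.
Context (R : realType) (G : ptopologicalType) (C : semigroupoid G).
Hypothesis GC : locally_compact_semigroupoid C.
Variables (lambda : measure_family R G) (theta : nat -> measure_family R G).
Variable u : nat -> nat.
Hypothesis theta_ad : forall n, adapted C lambda (theta n).

Let w l := theta (u l).
Let w_ad l : adapted C lambda (w l). Proof. exact: theta_ad. Qed.
Local Notation pi := (mixture_system w).
Local Notation half := (2^-1 : R).

Definition tail_average i (f : G -> R) z : R :=
  average C pi f z - \sum_(l < i) dyadic R l * average C (w l) f z.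

Section bounded_function.
Variables (f : G -> R) (M : R).
Hypothesis mf : measurable_fun [set: borel G] (f : borel G -> R).
Hypothesis fM : forall y, `|f y| <= M.

Let M0 : 0 <= M. Proof. exact: le_trans (fM point). Qed.

Lemma tail_average_le i z : `|tail_average i f z| <= M * half ^+ i.
Proof. exact: average_mixture_dist. Qed.

(** Only components of index at least [i] contribute to the tail, and all of
    them are almost invariant under [z]. *)
Lemma tail_average_dist i z :
  (forall j, (i <= j)%N -> (total_variation_norm (fun A =>
     w j (tgt C z) A - translate C z (w j (src C z)) A)%E
     <= (half ^+ j)%:E)%E) ->
  `|tail_average i f z - tail_average i f (tgt C z)| <=
  half ^+ i * (2 * M * half ^+ i).
Proof.
move=> tv.
pose dl l := average C (w l) f z - average C (w l) f (tgt C z).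
have dlP j : (i <= j)%N -> `|dl j| <= 2 * M * half ^+ i.
  move=> ij; apply: (@le_trans _ _ (2 * M * half ^+ j)).
    by apply: average_translate_dist (tv j ij) => //; exact: exprn_ge0.
  by rewrite ler_wpM2l ?mulr_ge0// ler_wiXn2l// half_le1.
have sumP n : `|\sum_(l < i + n) dyadic R l * dl l -
    \sum_(l < i) dyadic R l * dl l| <=
    (half ^+ i - half ^+ (i + n)) * (2 * M * half ^+ i).
  elim: n => [|n ih]; first by rewrite addn0 !subrr normr0 mul0r.
  rewrite addnS big_ord_recr/= addrAC (le_trans (ler_normD _ _))//.
  rewrite normrM (ger0_norm (dyadic_ge0 _ _)).
  apply: le_trans (lerD ih (ler_wpM2l (dyadic_ge0 _ _) (dlP _ (leq_addr n i)))) _.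
  rewrite /dyadic -mulrDl exprS; apply: ler_wpM2r; last by lra.
  by rewrite !mulr_ge0// exprn_ge0.
(* The components between [i] and [i + n] are controlled by [sumP]; those beyond
   [i + n] have a total mass that vanishes as [n] grows. *)
apply/ler_addgt0Pr => e e0.
have eM : 0 < e / (2 * M + 1) by rewrite divr_gt0// ltr_wpDl// mulr_ge0.
have [n] := expr_small (half_lt1 R) eM.
rewrite ler_pdivlMr ?ltr_wpDl ?mulr_ge0// => hn.
have {hn}hn : 2 * M * half ^+ (i + n) <= e.
  apply: le_trans hn; rewrite exprD.
  have h1 : 0 <= 1 - half ^+ i.
    by rewrite subr_ge0 exprn_ile1// half_le1.
  have hn0 : 0 <= half ^+ n by exact: exprn_ge0.
  have : 0 <= (1 - half ^+ i) * (half ^+ n * (2 * M)) by rewrite !mulr_ge0.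
  lra.
have Dz := average_mixture_dist GC mf fM (i + n) z w_ad.
have Dt := average_mixture_dist GC mf fM (i + n) (tgt C z) w_ad.
have split_dl k : \sum_(l < k) dyadic R l * dl l =
    \sum_(l < k) dyadic R l * average C (w l) f z -
    \sum_(l < k) dyadic R l * average C (w l) f (tgt C z).
  by rewrite -sumrB; apply: eq_bigr => l _; rewrite mulrBr.
have := sumP n; rewrite !split_dl /tail_average mulrBl.
have B0 : 0 <= half ^+ (i + n) * (2 * M * half ^+ i).
  by rewrite !mulr_ge0// exprn_ge0.
by move: Dz Dt hn B0; rewrite !ler_norml; lra.
Qed.

Section contraction.
Variables (x : G) (N : set (borel G)).
Hypothesis mN : measurable N.
Hypothesis N0 : lambda x N = 0%E.
Hypothesis f_harmonic :
  forall z, tgt C z = x -> ~ N z -> f z = average C pi f z.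

(** Subtracting the constant carried by the tail, harmonicity expresses [f - a]
    at [z] as an average, of total weight [1 - 2^-i], of [f - a] over the points
    reached from [z] in one step, up to the oscillation of the tail.  Iterating
    [m] times makes the weight [(1 - 2^-i)^m] small. *)
Lemma harmonic_contraction i a e m K : 0 <= e ->
  half ^+ i * a = tail_average i f x -> `|a| <= M ->
  (forall z, iter m (grow C theta (mkseq u i)) K z -> tgt C z = x ->
     `|tail_average i f z - tail_average i f x| <= half ^+ i * e) ->
  forall z, K z -> tgt C z = x -> ~ N z ->
  `|f z - a| <= (1 - half ^+ i) ^+ m * (2 * M) + e.
Proof.
move=> e0 aE aM; elim: m K => [|m ih] K tailK z Kz zx Nz.
  rewrite expr0 mul1r (le_trans (ler_normB _ _))//.
  by have := fM z; move: aM; lra.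
set B := (1 - half ^+ i) ^+ m * (2 * M) + e.
set s := mkseq u i in tailK.
have {}ih h : grow C theta s K h -> tgt C h = x -> ~ N h -> `|f h - a| <= B.
  by apply: ih => y; rewrite -/s -iterSr; exact: tailK.
have avgB l : (l < i)%N -> `|average C (w l) f z - a| <= B.
  move=> li.
  (* Almost every increment is in the support, so that the next point is in
     [grow C theta s K], and avoids the exceptional set [N]. *)
  have [Z [mZ Z0 suppZ]] :=
    support_negligible (w l (src C z)) (lc_second_countable GC).
  have mZ' : measurable (fiber C (src C z) `&` sg_mul C z @^-1` N : set (borel G)).
    exact: (@sg_mul_borel _ _ GC z (fiber_measurable GC _) _ mN).
  have N0' : lambda (tgt C z) N = 0%E by rewrite zx.
  have Z0' := translate_null (w_ad l) mN N0'.
  apply: (average_dist (lambda := lambda) GC mf fM (N := Z `|` _) (w_ad l)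
    (measurableU _ _ mZ mZ')).
    apply/negligibleP; first exact: measurableU.
    by apply: negligibleU; apply/negligibleP.
  move=> h hz /not_orP[nZ nN]; apply: ih.
  - apply: (grow_mul (n := u l)) => //; first by rewrite map_f// mem_iota.
    by apply: contrapT => /suppZ.
  - by rewrite tgt_mul//; exact/esym.
  - by move=> Nzh; apply: nN; split.
have zK : iter m.+1 (grow C theta s) K z by exact: sub_iter_grow.
have {tailK}tz := tailK z zK zx.
have sumB : `|\sum_(l < i) dyadic R l * (average C (w l) f z - a)| <=
    (1 - half ^+ i) * B.
  rewrite -sum_dyadic mulr_suml (le_trans (ler_norm_sum _ _ _))//.
  apply: ler_sum => l _; rewrite normrM (ger0_norm (dyadic_ge0 _ _)).
  by rewrite ler_wpM2l ?dyadic_ge0// avgB.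
(* The constants [a] add up to [(1 - 2^-i) a], and the tail accounts for the
   missing [2^-i a]. *)
have -> : f z - a = \sum_(l < i) dyadic R l * (average C (w l) f z - a) +
    (tail_average i f z - tail_average i f x).
  under eq_bigr do rewrite mulrBr.
  rewrite sumrB -mulr_suml sum_dyadic -aE /tail_average -f_harmonic//; lra.
rewrite (le_trans (ler_normD _ _))//; apply: le_trans (lerD sumB tz) _.
by rewrite /B exprS; lra.
Qed.

End contraction.

Variables (E : nat -> set G) (depth : nat -> nat).
Hypothesis E_mono : forall i j, (i <= j)%N -> E i `<=` E j.
Hypothesis E_cover : forall z, exists i, E i z.
Hypothesis depthP : forall i, (1 - half ^+ i) ^+ depth i <= half ^+ i.
Hypothesis u_invariant : forall i j, (i <= j)%N ->
  forall g, iter (depth i) (grow C theta (mkseq u i)) (E i) g ->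
    (total_variation_norm (fun A =>
       w j (tgt C g) A - translate C g (w j (src C g)) A)%E
     <= (half ^+ j)%:E)%E.

(** Applying the contraction at stage [i] with [depth i] steps, [f] is within
    [4 M 2^-i] of a constant [a i] on [E i], off a null set; any two points of
    the fiber lie in [E i] for all large [i]. *)
Lemma bounded_harmonic_constant x :
  {ae lambda x, forall z, tgt C z = x -> f z = average C pi f z} ->
  lambda x (~` fiber C x) = 0%E ->
  exists c, {ae lambda x, forall z, f z = c}.
Proof.
move=> [N [mN N0 badN]] Fx.
have harm z : tgt C z = x -> ~ N z -> f z = average C pi f z.
  by move=> zx Nz; apply: contrapT => fz; apply: Nz; apply: badN => /(_ zx).
pose a i := 2 ^+ i * tail_average i f x.
have near_a i z : E i z -> tgt C z = x -> ~ N z ->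
    `|f z - a i| <= 4 * M * half ^+ i.
  move=> Ez zx Nz.
  have h0 : 0 <= half ^+ i by exact: exprn_ge0.
  have aE : half ^+ i * a i = tail_average i f x.
    by rewrite /a mulrA -exprMn mulVf ?expr1n ?mul1r.
  have aM : `|a i| <= M.
    rewrite -(@ler_pM2l _ (half ^+ i)) ?exprn_gt0// [leRHS]mulrC.
    by rewrite -{1}(ger0_norm h0) -normrM aE tail_average_le.
  have e0 : 0 <= 2 * M * half ^+ i by rewrite !mulr_ge0.
  have := harmonic_contraction mN N0 harm e0 aE aM _ Ez zx Nz.
  move=> /(_ (depth i)); set c := _ ^+ depth i => H.
  have cP : c * (2 * M) <= half ^+ i * (2 * M).
    by rewrite ler_wpM2r ?mulr_ge0//; exact: depthP.
  apply: le_trans (H _) _; last by lra.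
  move=> y yK yx; rewrite -yx; apply: tail_average_dist => j ij.
  exact: u_invariant yK.
have const z z' : tgt C z = x -> ~ N z -> tgt C z' = x -> ~ N z' -> f z = f z'.
  move=> zx Nz zx' Nz'; apply/eqP; rewrite -subr_eq0 -normr_le0.
  apply/ler_addgt0Pr => e e0; rewrite add0r.
  have eM : 0 < e / (8 * M + 1) by rewrite divr_gt0// ltr_wpDl// mulr_ge0.
  have [n] := expr_small (half_lt1 R) eM.
  rewrite ler_pdivlMr ?ltr_wpDl ?mulr_ge0// => hn.
  have [i Ei] := E_cover z; have [j Ej] := E_cover z'.
  pose k := maxn n (maxn i j).
  have Ekz : E k z by apply: E_mono Ei; rewrite !leq_max leqnn orbT.
  have Ekz' : E k z' by apply: E_mono Ej; rewrite !leq_max leqnn !orbT.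
  have hk : half ^+ k * (8 * M + 1) <= e.
    apply: le_trans hn; rewrite ler_wpM2r ?addr_ge0 ?mulr_ge0//.
    by rewrite ler_wiXn2l ?leq_maxl// half_le1.
  have h0 : 0 <= half ^+ k by exact: exprn_ge0.
  have := near_a k z Ekz zx Nz; have := near_a k z' Ekz' zx' Nz'.
  by rewrite !ler_norml; lra.
have mF : measurable (~` fiber C x : set (borel G)).
  by apply: measurableC; exact: fiber_measurable.
have null : (lambda x).-negligible (N `|` ~` fiber C x).
  by apply: negligibleU; apply/negligibleP.
have [[z0 [z0x Nz0]]|no] := pselect (exists z, tgt C z = x /\ ~ N z).
  exists (f z0); apply: negligibleS null => z /= fz.
  apply: contrapT => /not_orP[Nz /contrapT zx]; apply: fz; exact: const.
exists 0; apply: negligibleS null => z _.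
by apply: contrapT => /not_orP[Nz /contrapT zx]; apply: no; exists z.
Qed.

End bounded_function.

End harmonic.

(** * The Liouville property *)

Section essentially_bounded.
Context (R : realType) (G : ptopologicalType) (C : semigroupoid G).
Hypothesis GC : locally_compact_semigroupoid C.
Variable lambda : measure_family R G.

Lemma Linfty_bounded (mu : {measure set (borel G) -> \bar R})
    (f : borel G -> R) : mu [set: G] <> 0%E -> f \in Lfun mu +oo%E ->
  measurable_fun [set: borel G] f /\
  exists2 M, 0 <= M & {ae mu, forall y, `|f y| <= M}.
Proof.
move=> mu0; rewrite inE => /andP[mf ff]; split; first by move: mf; rewrite inE.
move: ff; rewrite inE /finite_norm /= unlock lt0e measure_ge0 andbT.
move/eqP : mu0 => -> /= /(@ess_supr_bounded _ _ _ mu (fun y => `|f y|))[M fM].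
exists `|M| => //; apply: filterS fM => y; move/le_trans; apply.
exact: ler_norm.
Qed.

(** The averages at a point of the fiber of [x] only depend on the class modulo
    [lambda x], by absolute continuity of the translates. *)
Lemma average_ae_eq rho x (f g : G -> R) z : adapted C lambda rho ->
  measurable_fun [set: borel G] (f : borel G -> R) ->
  measurable_fun [set: borel G] (g : borel G -> R) ->
  {ae lambda x, forall y, f y = g y} -> tgt C z = x ->
  average C rho f z = average C rho g z.
Proof.
move=> ad mf mg [N [mN N0 fgN]] zx; congr fine.
apply: ae_eq_integral; first exact: fiber_measurable.
- by apply/measurable_EFinP; exact: measurable_translate.
- by apply/measurable_EFinP; exact: measurable_translate.
have N0' : lambda (tgt C z) N = 0%E by rewrite zx.
exists (fiber C (src C z) `&` sg_mul C z @^-1` N); split.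
- exact: (@sg_mul_borel _ _ GC z (fiber_measurable GC _) _ mN).
- exact: translate_null ad mN N0'.
- move=> h /= /not_implyP[hz fg]; split=> //; apply: fgN => /= E.
  by apply: fg; rewrite E.
Qed.

Lemma average_cst rho (c : R) z : adapted C lambda rho ->
  average C rho (fun=> c) z = c.
Proof.
move=> ad; rewrite /average Rintegral_cst; last exact: fiber_measurable.
by rewrite (adapted_fiber1 GC ad (unit_src C z)) mulr1.
Qed.

End essentially_bounded.

(** An essentially bounded function is truncated to a bounded one; this changes
    neither its class nor, by [average_ae_eq], its averages. *)
Lemma harmonic_constant (R : realType) (G : ptopologicalType)
    (C : semigroupoid G) (lambda : measure_family R G)
    (theta : nat -> measure_family R G) (u : nat -> nat) (E : nat -> set G)
    (depth : nat -> nat) x (f : borel G -> R) :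
  locally_compact_semigroupoid C -> continuous_system C lambda ->
  (forall n, adapted C lambda (theta n)) ->
  (forall i j, (i <= j)%N -> E i `<=` E j) -> (forall z, exists i, E i z) ->
  (forall i, (1 - (2^-1) ^+ i) ^+ depth i <= (2^-1) ^+ i :> R) ->
  (forall i j, (i <= j)%N ->
    forall g, iter (depth i) (grow C theta (mkseq u i)) (E i) g ->
      (total_variation_norm (fun A =>
         theta (u j) (tgt C g) A - translate C g (theta (u j) (src C g)) A)%E
       <= ((2^-1) ^+ j)%:E)%E) ->
  sg_units C x -> f \in Lfun (lambda x) +oo%E ->
  {ae lambda x, forall z,
    average C (mixture_system (fun l => theta (u l))) f z = f z} ->
  exists c, {ae lambda x, forall z, f z = c}.
Proof.
move=> GC sys ad Emono Ecover depthP uP Ux fL harm.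
have pi_ad := mixture_system_adapted (lc_hausdorff GC) (fun l => ad (u l)).
have [mf [M M0 fM]] := Linfty_bounded (cs_nonzero sys Ux) fL.
pose g y : R := Num.max (- M) (Num.min M (f y)).
have mg : measurable_fun [set: borel G] (g : borel G -> R).
  by apply: measurable_maxr => //; exact: measurable_minr.
have gM y : `|g y| <= M.
  by rewrite /g ler_norml le_max lexx /= ge_max ge_min lexx /=; lra.
have fg : {ae lambda x, forall y, f y = g y}.
  apply: filterS fM => y; rewrite ler_norml => /andP[f1 f2].
  by rewrite /g (min_idPr f2) (max_idPr f1).
have Fx := cs_fiber sys Ux.
have gharm : {ae lambda x, forall z, tgt C z = x ->
    g z = average C (mixture_system (fun l => theta (u l))) g z}.
  apply: (filterS2 (ae_filter_ringOfSetsType _) _ harm fg) => z fz fgz zx.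
  by rewrite -(average_ae_eq GC pi_ad mf mg fg zx) fz.
have [c gc] :=
  bounded_harmonic_constant GC ad mg gM Emono Ecover depthP uP gharm Fx.
by exists c; apply: (filterS2 (ae_filter_ringOfSetsType _) _ fg gc) => z ->.
Qed.

Theorem theorem5p6 (R : realType) (G : ptopologicalType) (C : semigroupoid G)
    (lambda : measure_family R G) :
  locally_compact_semigroupoid C ->
  quasi_Haar C lambda ->
  uniform_tight_Reiter C lambda ->
  Liouville C lambda.
Proof.
move=> GC qH [theta [ad reiter tight]].
have [E [cE Emono Ecover]] :=
  compact_exhaustion (lc_second_countable GC) (lc_locally_compact GC).
have /choice[depth depthP] : forall i, exists m,
    (1 - (2^-1) ^+ i) ^+ m <= (2^-1) ^+ i :> R.
  move=> i; apply: expr_small; last by rewrite exprn_gt0.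
  have h0 : 0 < (2^-1) ^+ i :> R by rewrite exprn_gt0.
  have h1 : (2^-1) ^+ i <= 1 :> R.
    by rewrite exprn_ile1// half_le1.
  by apply/andP; split; lra.
have [u uP] := select_components GC depth tight reiter cE.
pose pi := mixture_system (fun l => theta (u l)).
have pi_ad : adapted C lambda pi.
  exact: mixture_system_adapted (lc_hausdorff GC) (fun l => ad (u l)).
exists pi => // x Ux.
have sys := qH_system qH; have x0 := cs_nonzero sys Ux.
have Fx : {ae lambda x, forall z, tgt C z = x}.
  apply/negligibleP; last exact: (cs_fiber sys Ux).
  by apply: measurableC; exact: fiber_measurable.
apply/seteqP; split=> f [fL H]; split=> //; have [fLr fLi] := fL.
  have hr := harmonic_constant GC sys ad Emono Ecover depthP uP Ux fLr.
  have hi := harmonic_constant GC sys ad Emono Ecover depthP uP Ux fLi.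
  have [|cr fr] := hr.
    apply: (@filterS _ _ (ae_filter_ringOfSetsType (lambda x)) _ _ _ H) => z.
    by rewrite markov_operatorE => <-.
  have [|ci fi] := hi.
    apply: (@filterS _ _ (ae_filter_ringOfSetsType (lambda x)) _ _ _ H) => z.
    by rewrite markov_operatorE => <-.
  exists (Complex cr ci); apply: (filterS2 (ae_filter_ringOfSetsType _) _ fr fi) => z.
  by case: (f z) => a b /= -> ->.
have [c fc] := H.
have [mr _] := Linfty_bounded x0 fLr; have [mi _] := Linfty_bounded x0 fLi.
have fcr : {ae lambda x, forall y, complex.Re (f y) = complex.Re c}.
  by apply: (@filterS _ _ (ae_filter_ringOfSetsType _) _ _ _ fc) => y /= ->.
have fci : {ae lambda x, forall y, complex.Im (f y) = complex.Im c}.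
  by apply: (@filterS _ _ (ae_filter_ringOfSetsType _) _ _ _ fc) => y /= ->.
apply: (filterS2 (ae_filter_ringOfSetsType _) _ Fx fc) => z zx fz.
rewrite markov_operatorE fz.
rewrite (average_ae_eq GC pi_ad mr (measurable_cst _) fcr zx).
rewrite (average_ae_eq GC pi_ad mi (measurable_cst _) fci zx).
by rewrite !(average_cst GC _ _ pi_ad); case: (c).
Qed.
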